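(* Let $N\ge 2$ and let $x_N\ge x_{N-1}\ge\dots\ge x_1>0$ be the users' SNRs. Among all feasible orderings $O$ (with $N-1$ pairs), the maximum achievable common rate $C_R(G_O)$ is maximized by the ordering $$O_{CR}=\{\{U_1,U_2\},\{U_2,U_3\},\{U_3,U_4\},\dots,\{U_{N-1},U_N\}\}.$$ Moreover, the maximum achievable common rate is $$C_R(G_{O_{CR}})=\min_{i\in\{1,\dots,N-1\}}\left\{\frac{1}{2(N-1)}\log_2\left(x_i+\frac{x_i}{x_i+x_{i+1}}\right)\right\}.$$
   Context: There are $N\ge2$ users $U_1,\dots,U_N$ with SNRs $x_N\ge\dots\ge x_1>0$ (real numbers). An ordering $O$ is a set of unordered pairs of distinct users; its client graph $G_O=(V,E)$ is the simple graph on $V=\{v_1,\dots,v_N\}$ with $v_iv_j\in E$ iff $\{U_i,U_j\}\in O$. Only orderings with $N-1$ pairs are considered; such an ordering is feasible exactly when $G_O$ is a tree. For a feasible ordering $O$, whenever $v_iv_j\in E$ the rate $R_i$ of user $U_i$ is subject to the bound $R_i\le \frac{1}{2(N-1)}\log_2\left(\frac{x_i}{x_i+x_j}+x_i\right)$. The maximum achievable rate of $U_i$ is therefore $$B_i(G_O)=\min_{j:\,v_iv_j\in E}\frac{1}{2(N-1)}\log_2\left(x_i+\frac{x_i}{x_i+x_j}\right),$$ and the maximum achievable common rate is $C_R(G_O)=\min_{1\le i\le N}B_i(G_O)$. *)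

(* Defs.v *)
From mathcomp Require Import all_boot all_order all_algebra.
From mathcomp Require Import reals exp.

Set Implicit Arguments.
Unset Strict Implicit.
Unset Printing Implicit Defensive.

Import Order.TTheory GRing.Theory Num.Theory.
Local Open Scope ring_scope.

(* The junk value 0 is returned only when P is empty; otherwise fmin P F is
   attained on P and is a lower bound there (fmin_attained, fmin_le). *)
Definition fmin (R : realType) (I : finType) (P : pred I) (F : I -> R) : R :=
  if [pick i | P i] is Some i0 then \big[Num.min/F i0]_(i | P i) F i else 0.

Lemma fmin_le (R : realType) (I : finType) (P : pred I) (F : I -> R) (i : I) :
  P i -> fmin P F <= F i.
Proof.
rewrite /fmin => Pi; case: pickP => [i0 _ | /(_ i)]; last by rewrite Pi.
exact: bigmin_le_cond.
Qed.

Lemma fmin_attained (R : realType) (I : finType) (P : pred I) (F : I -> R)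
  (i : I) : P i -> exists2 j, P j & fmin P F = F j.
Proof.
rewrite /fmin => Pi; case: pickP => [i0 Pi0 | /(_ i)]; last by rewrite Pi.
elim/big_ind: _ => [|a b [j Pj ->] [k Pk ->]|j Pj]; first by exists i0.
  by case: (leP (F j) (F k)) => _; [exists j | exists k].
by exists j.
Qed.

Definition log2 (R : realType) (t : R) : R := ln t / ln 2.

(* For a symmetric irreflexive e, i.e. a simple graph.  [ucycle e s] also holds
   of the degenerate closed walks of length at most 2, hence the bound. *)
Definition is_tree (T : finType) (e : rel T) : Prop :=
  [/\ (0 < #|T|)%N,
      forall u v : T, connect e u v
    & forall s : seq T, ucycle e s -> (size s <= 2)%N].

(* The users U_1, ..., U_N are indexed by 'I_N, from 0. *)

Definition is_ordering (N : nat) (O : {set {set 'I_N}}) : Prop :=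
  forall p : {set 'I_N}, p \in O -> #|p| = 2.

Definition client_graph (N : nat) (O : {set {set 'I_N}}) : rel 'I_N :=
  fun i j => [set i; j] \in O.

Definition feasible (N : nat) (O : {set {set 'I_N}}) : Prop :=
  [/\ is_ordering O, #|O| = (N - 1)%N & is_tree (client_graph O)].

(* The bound on the rate of a user of SNR a exchanging with one of SNR b. *)
Definition rate_bound (R : realType) (N : nat) (a b : R) : R :=
  1 / (2 * (N%:R - 1)) * log2 (a + a / (a + b)).

Definition max_rate (R : realType) (N : nat) (x : 'I_N -> R) (e : rel 'I_N)
  (i : 'I_N) : R :=
  fmin (fun j => e i j) (fun j => rate_bound N (x i) (x j)).

Definition common_rate (R : realType) (N : nat) (x : 'I_N -> R)
  (e : rel 'I_N) : R :=
  fmin xpredT (fun i => max_rate x e i).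

(* [ordS i] is i + 1 as soon as i + 1 < N. *)
Definition O_CR (N : nat) : {set {set 'I_N}} :=
  [set [set i; ordS i] | i : 'I_N & (i.+1 < N)%N].

(* Main.v *)
Require Import Defs.
From mathcomp Require Import all_boot all_order all_algebra.
From mathcomp Require Import reals exp.
From mathcomp Require Import zify.

Import Order.TTheory GRing.Theory Num.Theory.
Local Open Scope ring_scope.

(* The bound [a + a / (a + b)] increases with [a] and decreases with [b], so
   on an edge the user of smaller SNR is the binding one.  Let [{i, i+1}] be the
   edge of the path where the common rate is attained.  A connected graph has
   an edge from [a <= i] to [b >= i+1], and the bound of [a] on that edge is at
   most the bound of [i] on [{i, i+1}]. *)

(** Cross-multiplied, the comparison of the fractions reduces to [a * b' <= a' * b]. At [N = 1] the
    prefactor is [1 / 0 = 0], so it is still nonnegative. *)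
Lemma rate_bound_le (R : realType) (N : nat) (a b a' b' : R) :
  (1 <= N)%N -> 0 < a -> a <= a' -> 0 < b' -> b' <= b ->
  rate_bound N a b <= rate_bound N a' b'.
Proof.
move=> N_ge1 a_gt0 le_aa' b'_gt0 le_b'b.
have a'_gt0 := lt_le_trans a_gt0 le_aa'; have b_gt0 := lt_le_trans b'_gt0 le_b'b.
have frac_le : a / (a + b) <= a' / (a' + b').
  rewrite ler_pdivrMr ?addr_gt0// mulrAC ler_pdivlMr ?addr_gt0//.
  by rewrite !mulrDr [a' * a]mulrC lerD2l ler_pM// ltW.
apply: ler_wpM2l.
  by rewrite divr_ge0// mulr_ge0// subr_ge0 -[1]/(1%:R) ler_nat.
rewrite /log2 ler_pM2r; last by rewrite invr_gt0 ln_gt0// ltr1n.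
by rewrite ler_ln ?lerD// posrE addr_gt0// divr_gt0// addr_gt0.
Qed.

Lemma common_rate_le (R : realType) (N : nat) (x : 'I_N -> R) (e : rel 'I_N)
  (i j : 'I_N) : e i j -> common_rate x e <= rate_bound N (x i) (x j).
Proof.
move=> eij; apply: (le_trans (@fmin_le _ _ xpredT (max_rate x e) i isT)).
exact: (@fmin_le _ _ (fun j => e i j)).
Qed.

(** A neighbour at every vertex keeps each inner [fmin] away from its default value 0, so both
    nested minima are attained. *)
Lemma common_rate_attained (R : realType) (N : nat) (x : 'I_N -> R)
  (e : rel 'I_N) :
  (0 < N)%N -> (forall i, exists j, e i j) ->
  exists i j, e i j /\ common_rate x e = rate_bound N (x i) (x j).
Proof.
move=> N_gt0 e_total; rewrite /common_rate.
have [i _ ->] := @fmin_attained _ _ xpredT (max_rate x e) (Ordinal N_gt0) isT.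
rewrite /max_rate; have [j eij] := e_total i.
have [k eik ->] := @fmin_attained _ _ (fun j => e i j)
  (fun j => rate_bound N (x i) (x j)) j eij.
by exists i, k.
Qed.

(** Induction along a path from [u] to [v]: its first step out of [A] is the required edge. *)
Lemma connect_crossing (T : finType) (e : rel T) (A : pred T) (u v : T) :
  connect e u v -> A u -> ~~ A v -> exists a b, [/\ e a b, A a & ~~ A b].
Proof.
case/connectP=> p; elim: p u => [|w p IHp] u /=; first by move=> _ -> ->.
case/andP=> euw ewp v_last Au nAv; case: (boolP (A w)) => Aw.
  exact: (IHp w).
by exists u, w.
Qed.

Lemma val_ordS (N : nat) (i : 'I_N) : (i.+1 < N)%N -> ordS i = i.+1 :> nat.
Proof. by move=> i1_lt /=; rewrite modn_small. Qed.

Lemma client_graph_O_CR (N : nat) (i j : 'I_N) :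
  client_graph (O_CR N) i j = (i.+1 == j) || (j.+1 == i).
Proof.
rewrite /client_graph; apply/imsetP/idP => [[k] | ].
  rewrite inE => k1_lt eq_ij.
  (* Testing the equality of the two pairs at their four listed elements leaves only linear
     arithmetic on indices. *)
  have /setP eq_ij_mem := eq_ij.
  have := eq_ij_mem i; have := eq_ij_mem j.
  have := eq_ij_mem k; have := eq_ij_mem (ordS k).
  rewrite !inE -!val_eqE /= modn_small//; lia.
have ordSE (k l : 'I_N) : k.+1 = l -> l = ordS k.
  by move=> kl; apply: val_inj; rewrite /= modn_small// kl.
case/orP=> /eqP h.
  by exists i; [rewrite inE h | rewrite (ordSE i j h)].
by exists j; [rewrite inE h | rewrite (ordSE j i h) setUC].
Qed.

Lemma path_graph_acyclic (N : nat) (s : seq 'I_N) :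
  ucycle (client_graph (O_CR N)) s -> (size s <= 2)%N.
Proof.
case: s => // i0 s0; set s := i0 :: s0.
case/andP=> s_cycle s_uniq.
(* Both neighbours along [s] of its largest vertex [m] are [m - 1]. *)
have [m ms m_max] : exists2 m : 'I_N, m \in s & forall j : 'I_N, j \in s -> (j <= m)%N.
  have i0s : i0 \in s by rewrite mem_head.
  by case: (arg_maxnP (fun i : 'I_N => i) i0s) => m ms m_max; exists m.
(* Rotating the cycle to start at [m] makes the second and the last entries the neighbours of
   [m]. *)
have [k p rot_s] := rot_to ms.
rewrite -(size_rot k) rot_s.
have p_max j : j \in m :: p -> (j <= m)%N by rewrite -rot_s mem_rot => /m_max.
move: s_cycle s_uniq; rewrite -(rot_cycle k) -(rot_uniq k) rot_s.
case: p p_max {rot_s} => [//|y q] p_max.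
rewrite (cycle_path m) [last _ _]/= [path _ _ _]/= !client_graph_O_CR.
case/and3P=> last_m m_y _ /and3P[_ y_notin_q _].
have y_le : (y <= m)%N by apply: p_max; rewrite !inE eqxx orbT.
have last_le : (last y q <= m)%N by apply: p_max; rewrite inE mem_last orbT.
have predP (j : 'I_N) :
    (j <= m)%N -> (j.+1 == m) || (m.+1 == j) -> j.+1 = m by lia.
have last_y : last y q = y.
  apply: val_inj; apply: succn_inj.
  by rewrite (predP _ last_le last_m) (predP y y_le)// orbC.
(* A nonempty tail after [y] would end in [y] again, against uniqueness. *)
case: q y_notin_q last_y {p_max last_m last_le} => // z q y_notin_q /= last_y.
by rewrite -last_y mem_last in y_notin_q.
Qed.

Lemma path_graph_connected (N : nat) (u v : 'I_N) :
  connect (client_graph (O_CR N)) u v.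
Proof.
have N_gt0 : (0 < N)%N by case: u => ? /(leq_ltn_trans (leq0n _)).
have sym : connect_sym (client_graph (O_CR N)).
  by apply: sym_connect_sym => i j; rewrite !client_graph_O_CR orbC.
have from0 n (n_lt : (n < N)%N) :
    connect (client_graph (O_CR N)) (Ordinal N_gt0) (Ordinal n_lt).
  elim: n n_lt => [|n IHn] n_lt.
    by rewrite (_ : Ordinal n_lt = Ordinal N_gt0)//; apply: val_inj.
  apply: (connect_trans (IHn (ltnW n_lt))); apply: connect1.
  by rewrite client_graph_O_CR eqxx.
case: u v => [u u_lt] [v v_lt].
by apply: connect_trans (from0 v v_lt); rewrite sym.
Qed.

Lemma card_O_CR (N : nat) : #|O_CR N| = (N - 1)%N.
Proof.
rewrite card_in_imset; last first.
  (* If [i] and [j] differed, equal pairs would force both [i = j + 1] and [j = i + 1]. *)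
  move=> i j; rewrite !inE => i1_lt j1_lt /setP eq_ij; apply: val_inj => /=.
  have := eq_ij i; have := eq_ij j.
  rewrite !inE -!val_eqE /= !modn_small//; lia.
case: N => [|N]; first by apply: eq_card0 => -[].
have -> : [set i : 'I_N.+1 | (i.+1 < N.+1)%N] = [set~ ord_max].
  by apply/setP => i; rewrite !inE -val_eqE /=; have := ltn_ord i; lia.
by rewrite cardsC1 card_ord subn1.
Qed.

Lemma feasible_O_CR (N : nat) : (0 < N)%N -> feasible (O_CR N).
Proof.
move=> N_gt0; split; last 1 first.
- split; first by rewrite card_ord.
    exact: path_graph_connected.
  exact: path_graph_acyclic.
- move=> p /imsetP[i]; rewrite inE => i1_lt ->.
  by rewrite cards2 -val_eqE /= modn_small// neq_ltn ltnSn.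
- exact: card_O_CR.
Qed.

(** The left side minimizes over both orientations of each path edge, the right side over the
    increasing one only; by sortedness the decreasing one never gives a smaller bound. *)
Lemma common_rate_O_CR (R : realType) (N : nat) (x : 'I_N -> R) :
  (2 <= N)%N -> (forall i, 0 < x i) ->
  (forall i j : 'I_N, (i <= j)%N -> x i <= x j) ->
  common_rate x (client_graph (O_CR N)) =
  fmin (fun i : 'I_N => (i.+1 < N)%N)
       (fun i : 'I_N => rate_bound N (x i) (x (ordS i))).
Proof.
move=> N_ge2 x_gt0 x_sorted; have N_gt0 := ltnW N_ge2.
apply/le_anti/andP; split.
  (* [N_ge2] says that vertex 0 has a successor, so this minimum is not the default value. *)
  have [i i1_lt ->] := @fmin_attained _ _ (fun i : 'I_N => (i.+1 < N)%N)
    (fun i : 'I_N => rate_bound N (x i) (x (ordS i))) (Ordinal N_gt0) N_ge2.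
  by apply: common_rate_le; rewrite client_graph_O_CR val_ordS// eqxx.
have neighbour i : exists j, client_graph (O_CR N) i j.
  case: (ltnP i.+1 N) => i1.
    by exists (Ordinal i1); rewrite client_graph_O_CR eqxx.
  (* Here [i] is the last vertex; as [N >= 2] it is not 0, and [i.-1] is a genuine neighbour. *)
  have i_lt : (i.-1 < N)%N := leq_ltn_trans (leq_pred i) (ltn_ord i).
  by exists (Ordinal i_lt); rewrite client_graph_O_CR /=; lia.
have [i [j [eij ->]]] := common_rate_attained R N x _ N_gt0 neighbour.
(* [k] is the smaller endpoint of the edge [{i, j}], whichever orientation attains the minimum. *)
have [k [k1_lt xki xjk]] :
    exists k : 'I_N, [/\ (k.+1 < N)%N, x k <= x i & x j <= x (ordS k)].
  move: eij; rewrite client_graph_O_CR => /orP[/eqP ij | /eqP ji].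
    have i1_lt : (i.+1 < N)%N by rewrite ij.
    by exists i; split; rewrite // x_sorted// val_ordS// ij.
  have j1_lt : (j.+1 < N)%N by rewrite ji.
  by exists j; split; rewrite // x_sorted// ?val_ordS// -ji.
apply: le_trans (rate_bound_le _ N _ _ _ _ N_gt0 (x_gt0 k) xki (x_gt0 j) xjk).
exact: (@fmin_le _ _ (fun i : 'I_N => (i.+1 < N)%N)).
Qed.

Theorem theorem2 (R : realType) (N : nat) (x : 'I_N -> R)
  (hN : (2 <= N)%N)
  (x_gt0 : forall i : 'I_N, 0 < x i)
  (x_sorted : forall i j : 'I_N, (i <= j)%N -> x i <= x j) :
  [/\ feasible (O_CR N),
      (forall O : {set {set 'I_N}}, feasible O ->
         common_rate x (client_graph O)
           <= common_rate x (client_graph (O_CR N)))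
    & common_rate x (client_graph (O_CR N)) =
      fmin (fun i : 'I_N => (i.+1 < N)%N)
        (fun i : 'I_N =>
           1 / (2 * (N%:R - 1)) * log2 (x i + x i / (x i + x (ordS i))))].
Proof.
have N_gt0 := ltnW hN.
split; [exact: feasible_O_CR | | exact: common_rate_O_CR].
move=> O [_ _ [_ O_connected _]]; rewrite common_rate_O_CR//.
have [i i1_lt ->] := @fmin_attained _ _ (fun i : 'I_N => (i.+1 < N)%N)
  (fun i : 'I_N => rate_bound N (x i) (x (ordS i))) (Ordinal N_gt0) hN.
have [|a [b [eab a_le b_gt]]] := connect_crossing _ _ (fun k : 'I_N => (k <= i)%N)
  _ _ (O_connected i (ordS i)) (leqnn i).
  by rewrite val_ordS// ltnn.
apply: le_trans (common_rate_le _ _ x _ _ _ eab) _.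
(* Sortedness turns [a <= i] and [i + 1 <= b] into the two SNR comparisons required. *)
apply: rate_bound_le => //; apply: x_sorted => //.
by rewrite val_ordS// ltnNge.
Qed.
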